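(* Let $\mathcal{A}$ and $\mathcal{B}$ be 2-torsion free rings such that each of them is either semiprime or satisfies Condition (P). Let $\mathcal{M}$ be a 2-torsion free faithful $(\mathcal{A},\mathcal{B})$-bimodule such that for every $m\in\mathcal{M}$: if $\mathcal{A}m=\{0\}$ then $m=0$, and if $m\mathcal{B}=\{0\}$ then $m=0$. If $\Delta$ is a commuting Jordan derivation on the triangular ring $\mathfrak{T}=Tri(\mathcal{A},\mathcal{M},\mathcal{B})$, then $\Delta=0$.
   Context: Rings are associative and not assumed to be unital (nor commutative). A ring or module $X$ is 2-torsion free if $2x=0$ with $x\in X$ implies $x=0$. A ring $\mathcal{R}$ is semiprime if, for $a\in\mathcal{R}$, $a\mathcal{R}a=\{0\}$ implies $a=0$. A ring $\mathcal{R}$ satisfies Condition (P) if, for $a\in\mathcal{R}$, $xax=0$ for all $x\in\mathcal{R}$ implies $a=0$. An $(\mathcal{A},\mathcal{B})$-bimodule $\mathcal{M}$ is faithful if, for $a\in\mathcal{A}$, $a\mathcal{M}=\{0\}$ implies $a=0$, and, for $b\in\mathcal{B}$, $\mathcal{M}b=\{0\}$ implies $b=0$. The triangular ring $Tri(\mathcal{A},\mathcal{M},\mathcal{B})$ is the set of all matrices $\begin{bmatrix} a & m\\ 0 & b\end{bmatrix}$ with $a\in\mathcal{A}$, $m\in\mathcal{M}$, $b\in\mathcal{B}$, under the usual matrix addition and multiplication. A Jordan derivation on a ring $\mathcal{R}$ is an additive map $\Delta:\mathcal{R}\to\mathcal{R}$ with $\Delta(x^2)=\Delta(x)x+x\Delta(x)$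 for all $x\in\mathcal{R}$; a map $\Delta:\mathcal{R}\to\mathcal{R}$ is commuting if $\Delta(x)x=x\Delta(x)$ for all $x\in\mathcal{R}$. *)

(* Defs.v *)
From HB Require Import structures.
From mathcomp Require Import all_boot all_algebra.

Set Implicit Arguments.
Unset Strict Implicit.
Unset Printing Implicit Defensive.

Import GRing.Theory.
Local Open Scope ring_scope.

Declare Scope rng_scope.
Delimit Scope rng_scope with rng.

(* The rings of MathComp are all unital, so associative rings without an
   assumed unit are introduced on top of zmodType. *)
HB.mixin Record Zmodule_isRng R of GRing.Zmodule R := {
  rng_mul : R -> R -> R;
  rng_mulA : associative rng_mul;
  rng_mulDl : left_distributive rng_mul +%R;
  rng_mulDr : right_distributive rng_mul +%R
}.

#[short(type="rngType")]
HB.structure Definition Rng := {R of Zmodule_isRng R & GRing.Zmodule R}.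

(* Not overloading *, which ring_scope resolves to GRing.mul. *)
Notation "x ** y" := (rng_mul x y) (at level 40, left associativity) : rng_scope.
Local Open Scope rng_scope.

HB.mixin Record Zmodule_isBimodule (A B : rngType) M of GRing.Zmodule M := {
  lact : A -> M -> M;
  ract : M -> B -> M;
  lactA : forall (a a' : A) m, lact (a ** a') m = lact a (lact a' m);
  lactDl : forall (a a' : A) m, lact (a + a') m = lact a m + lact a' m;
  lactDr : forall a m m', lact a (m + m') = lact a m + lact a m';
  ractA : forall m (b b' : B), ract m (b ** b') = ract (ract m b) b';
  ractDl : forall m m' b, ract (m + m') b = ract m b + ract m' b;
  ractDr : forall m (b b' : B), ract m (b + b') = ract m b + ract m b';
  lractA : forall a m b, ract (lact a m) b = lact a (ract m b)
}.

#[short(type="bimodType")]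
HB.structure Definition Bimodule (A B : rngType) :=
  {M of Zmodule_isBimodule A B M & GRing.Zmodule M}.

Notation "a *l m" := (lact a m) (at level 40, left associativity) : rng_scope.
Notation "m *r b" := (ract m b) (at level 40, left associativity) : rng_scope.

Definition two_torsion_free (X : zmodType) : Prop :=
  forall x : X, x *+ 2 = 0 -> x = 0.

Definition semiprime (R : rngType) : Prop :=
  forall a : R, (forall x : R, a ** x ** a = 0) -> a = 0.

Definition condition_P (R : rngType) : Prop :=
  forall a : R, (forall x : R, x ** a ** x = 0) -> a = 0.

Definition faithful_bimodule (A B : rngType) (M : bimodType A B) : Prop :=
  (forall a : A, (forall m : M, a *l m = 0) -> a = 0) /\
  (forall b : B, (forall m : M, m *r b = 0) -> b = 0).

(* Tri a m b stands for the matrix [[a, m], [0, b]]. *)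
Record tri (A B : rngType) (M : bimodType A B) : Type :=
  Tri { tri_ul : A; tri_ur : M; tri_lr : B }.

Section TriangularRing.
Variables (A B : rngType) (M : bimodType A B).
Local Notation T := (tri M).

Definition tri_encode (x : T) : A * M * B := (tri_ul x, tri_ur x, tri_lr x).
Definition tri_decode (p : A * M * B) : T := Tri p.1.1 p.1.2 p.2.

Lemma tri_encodeK : cancel tri_encode tri_decode.
Proof. by case. Qed.

HB.instance Definition _ := Choice.copy T (can_type tri_encodeK).

Definition tri_zero : T := Tri 0 0 0.

Definition tri_opp (x : T) : T := Tri (- tri_ul x) (- tri_ur x) (- tri_lr x).

Definition tri_add (x y : T) : T :=
  Tri (tri_ul x + tri_ul y) (tri_ur x + tri_ur y) (tri_lr x + tri_lr y).

Definition tri_mul (x y : T) : T :=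
  Tri (tri_ul x ** tri_ul y)
      (tri_ul x *l tri_ur y + tri_ur x *r tri_lr y)
      (tri_lr x ** tri_lr y).

Lemma tri_addA : associative tri_add.
Proof. by move=> x y z; rewrite /tri_add /= !addrA. Qed.

Lemma tri_addC : commutative tri_add.
Proof. by move=> x y; congr Tri; rewrite addrC. Qed.

Lemma tri_add0 : left_id tri_zero tri_add.
Proof. by case=> a m b; rewrite /tri_add /= !add0r. Qed.

Lemma tri_addN : left_inverse tri_zero tri_opp tri_add.
Proof. by move=> x; rewrite /tri_add /= !addNr. Qed.

HB.instance Definition _ :=
  GRing.isZmodule.Build T tri_addA tri_addC tri_add0 tri_addN.

Lemma tri_mulA : associative tri_mul.
Proof.
move=> x y z; rewrite /tri_mul /= !rng_mulA; congr Tri.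
by rewrite lactDr ractDl lactA ractA lractA addrA.
Qed.

Lemma tri_mulDl : left_distributive tri_mul +%R.
Proof.
move=> x y z; congr Tri; rewrite /= ?rng_mulDl //.
by rewrite lactDl ractDl addrACA.
Qed.

Lemma tri_mulDr : right_distributive tri_mul +%R.
Proof.
move=> x y z; congr Tri; rewrite /= ?rng_mulDr //.
by rewrite lactDr ractDr addrACA.
Qed.

HB.instance Definition _ :=
  Zmodule_isRng.Build T tri_mulA tri_mulDl tri_mulDr.

End TriangularRing.

Definition jordan_derivation (R : rngType) (D : R -> R) : Prop :=
  {morph D : x y / x + y} /\ forall x : R, D (x ** x) = D x ** x + x ** D x.

Definition commuting (R : rngType) (D : R -> R) : Prop :=
  forall x : R, D x ** x = x ** D x.

(* Main.v *)
Require Import Defs.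
From HB Require Import structures.
From mathcomp Require Import all_boot all_algebra.

(** Linearizing, a commuting Jordan derivation [D] satisfies
    [D (xy + yx) = 2 (D x y + D y x) = 2 (x D y + y D x)].  Taking [x] in [A]
    and [y] in [B] shows that [D] preserves [A] and [B].  For [x = a] in [A]
    and [y = m] in [M], the [M]-component [q] of [D] satisfies
    [q (a m) = 2 (D a) m = 2 a q(m)]; computing [q (a a' m)] in two ways gives
    [2 a a' q(m) = 0], so [q = 0], and then [D = 0] on [A] and on [B] by
    faithfulness.  The [A]-component [p] of [D] on [M] kills [M B] and satisfies
    [p(m) m' + p(m') m = 0]; replacing [m'] by [m' b] gives [p(m) m' b = 0],
    hence [p = 0], and symmetrically for the [B]-component. *)

Set Implicit Arguments.
Unset Strict Implicit.
Unset Printing Implicit Defensive.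

Import GRing.Theory.
Local Open Scope ring_scope.
Local Open Scope rng_scope.

Section Rng.
Variable R : rngType.
Implicit Types x y : R.

Lemma rng_mul0r x : 0 ** x = 0.
Proof. by apply: (addrI (0 ** x)); rewrite -rng_mulDl !addr0. Qed.

Lemma rng_mulr0 x : x ** 0 = 0.
Proof. by apply: (addrI (x ** 0)); rewrite -rng_mulDr !addr0. Qed.

(** Both [a ** x ** a] and [x ** a ** x] contain the factor [a ** x]. Semiprimeness and Condition
    (P) enter only here. *)
Lemma left_annihilator_eq0 (a : R) :
  semiprime R \/ condition_P R -> (forall x, a ** x = 0) -> a = 0.
Proof.
move=> [spR | PR] ax0; first by apply: spR => x; rewrite ax0 rng_mul0r.
by apply: PR => x; rewrite -rng_mulA ax0 rng_mulr0.
Qed.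

Variable D : R -> R.
Hypotheses (D_jordan : jordan_derivation D) (D_comm : commuting D).

Lemma commuting_linearized x y : D x ** y + D y ** x = x ** D y + y ** D x.
Proof.
have := D_comm (x + y); rewrite D_jordan.1 !rng_mulDl !rng_mulDr !D_comm -!addrA.
by move/addrI; rewrite !addrA => /addIr.
Qed.

(** Commutation turns the Jordan identity into [D (z ** z) = (D z ** z) *+ 2], which is then
    polarized at [z = x + y]. *)
Lemma jordan_commuting_linearized x y :
  D (x ** y + y ** x) = (D x ** y + D y ** x) *+ 2.
Proof.
have [D_add D_sq] := D_jordan.
have sq z : D (z ** z) = (D z ** z) *+ 2 by rewrite D_sq -D_comm mulr2n.
have := sq (x + y); rewrite D_add !rng_mulDl !rng_mulDr.
(* Group the cross terms in the middle, so that the two squares can be cancelled at the ends. *)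
rewrite -![_ + (y ** x + _)]addrA (addrA (x ** y)).
rewrite -![_ + (D y ** x + _)]addrA (addrA (D x ** y)).
rewrite (D_add (x ** x)) (D_add (_ + _) (y ** y)) !sq 2!(mulrnDl 2).
by move/addrI/addIr.
Qed.

End Rng.

Section Bimodule.
Variables (A B : rngType) (M : bimodType A B).

Lemma lact0l (m : M) : 0 *l m = 0.
Proof. by apply: (addrI (0 *l m)); rewrite -lactDl !addr0. Qed.

Lemma lactr0 (a : A) : a *l (0 : M) = 0.
Proof. by apply: (addrI (a *l (0 : M))); rewrite -lactDr !addr0. Qed.

Lemma ract0l (b : B) : (0 : M) *r b = 0.
Proof. by apply: (addrI ((0 : M) *r b)); rewrite -ractDl !addr0. Qed.

Lemma ractr0 (m : M) : m *r 0 = 0.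
Proof. by apply: (addrI (m *r 0)); rewrite -ractDr !addr0. Qed.

Lemma lactMn (a : A) (m : M) n : a *l (m *+ n) = (a *l m) *+ n.
Proof. by elim: n => [|n IHn]; rewrite ?lactr0 // !mulrS lactDr IHn. Qed.

Lemma tri_two_torsion_free :
  two_torsion_free A -> two_torsion_free M -> two_torsion_free B ->
  two_torsion_free (tri M).
Proof.
move=> A_2tf M_2tf B_2tf [a m b]; rewrite mulr2n => -[a0 m0 b0].
by congr Tri; [apply: A_2tf | apply: M_2tf | apply: B_2tf]; rewrite mulr2n.
Qed.

Lemma tri_decomp (x : tri M) :
  x = Tri (tri_ul x) 0 0 + Tri 0 (tri_ur x) 0 + Tri 0 0 (tri_lr x).
Proof. by case: x => a m b; congr Tri; rewrite /= ?addr0 ?add0r. Qed.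

Lemma tri_mulE (a a' : A) (m m' : M) (b b' : B) :
  Tri a m b ** Tri a' m' b' = Tri (a ** a') (a *l m' + m *r b') (b ** b').
Proof. by []. Qed.

Lemma tri_zeroE : (0 : tri M) = Tri 0 0 0.
Proof. by []. Qed.

Lemma tri_addE (a a' : A) (m m' : M) (b b' : B) :
  Tri a m b + Tri a' m' b' = Tri (a + a') (m + m') (b + b').
Proof. by []. Qed.

End Bimodule.

Definition tri0E :=
  (rng_mul0r, rng_mulr0, lact0l, lactr0, ract0l, ractr0, addr0, add0r).

Theorem theorem2p4 (A B : rngType) (M : bimodType A B)
    (A_2tf : two_torsion_free A) (B_2tf : two_torsion_free B)
    (A_spP : semiprime A \/ condition_P A)
    (B_spP : semiprime B \/ condition_P B)
    (M_2tf : two_torsion_free M)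
    (M_faithful : faithful_bimodule M)
    (M_left : forall m : M, (forall a : A, a *l m = 0) -> m = 0)
    (M_right : forall m : M, (forall b : B, m *r b = 0) -> m = 0)
    (Delta : tri M -> tri M)
    (Delta_jordan : jordan_derivation Delta)
    (Delta_commuting : commuting Delta) :
  forall x : tri M, Delta x = 0.
Proof.
have T_2tf := tri_two_torsion_free A_2tf M_2tf B_2tf.
have D_add := Delta_jordan.1.
have D0 : Delta 0 = 0 by apply: (addrI (Delta 0)); rewrite -D_add !addr0.
have lin := jordan_commuting_linearized Delta_jordan Delta_commuting.
have com := commuting_linearized Delta_jordan Delta_commuting.
pose iA a : tri M := Tri a 0 0; pose iM m : tri M := Tri 0 m 0.
pose iB b : tri M := Tri 0 0 b.
(* When the Jordan product vanishes, [lin] kills twice the left sum; halve, then pass to the other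
   side by [com]. *)
have orth x y : x ** y + y ** x = 0 ->
      Delta x ** y + Delta y ** x = 0 /\ x ** Delta y + y ** Delta x = 0.
  by move=> xy0; rewrite -com; split; apply: T_2tf; rewrite -lin xy0 D0.
(* The first three are the entries of the first equation of [orth]; the last is the corner entry of
   the second. *)
have AB a b : [/\ tri_ul (Delta (iB b)) ** a = 0,
    tri_ur (Delta (iA a)) *r b = 0, tri_lr (Delta (iA a)) ** b = 0 &
    a *l tri_ur (Delta (iB b)) = 0].
  have ab0 : iA a ** iB b + iB b ** iA a = 0.
    by rewrite !tri_mulE !tri_addE !tri0E.
  have := orth _ _ ab0.
  case: (Delta (iA a)) (Delta (iB b)) => [a1 a2 a3] [b1 b2 b3].
  by rewrite !tri_mulE !tri_addE !tri0E tri_zeroE => -[[-> -> ->] [_ -> _]].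
pose d a := tri_ul (Delta (iA a)); pose e b := tri_lr (Delta (iB b)).
have DA a : Delta (iA a) = iA (d a).
  rewrite /d; have := AB a; case: (Delta (iA a)) => [a1 a2 a3] /= ABa.
  congr Tri; first by apply: M_right => b; case: (ABa b).
  by apply: (left_annihilator_eq0 B_spP) => b; case: (ABa b).
have DB b : Delta (iB b) = iB (e b).
  rewrite /e; have := AB^~ b; case: (Delta (iB b)) => [b1 b2 b3] /= ABb.
  congr Tri; last by apply: M_left => a; case: (ABb a).
  by apply: (left_annihilator_eq0 A_spP) => a; case: (ABb a).
pose p m := tri_ul (Delta (iM m)); pose q m := tri_ur (Delta (iM m)).
pose r m := tri_lr (Delta (iM m)).
have DM m : Delta (iM m) = Tri (p m) (q m) (r m).
  by rewrite /p /q /r; case: (Delta (iM m)).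
(* The Jordan product of [iA a] and [iM m] is [iM (a *l m)]; [lin] gives [q (a *l m)] as twice
   [d a *l m], which [com] rewrites. *)
have AM a m : [/\ a *l q m = d a *l m, q (a *l m) = (a *l q m) *+ 2 &
    r (a *l m) = 0].
  have := com (iA a) (iM m); have := lin (iA a) (iM m).
  rewrite DA DM !tri_mulE !tri_addE !tri0E -/(iM _) DM mulr2n.
  by rewrite !tri_addE !tri0E => -[_ -> ->] [_ ->].
have MB m b : [/\ q m *r b = m *r e b & p (m *r b) = 0].
  have := com (iM m) (iB b); have := lin (iM m) (iB b).
  rewrite DB DM !tri_mulE !tri_addE !tri0E -/(iM _) DM mulr2n.
  by rewrite !tri_addE !tri0E => -[-> _ _] [->].
have q0 m : q m = 0.
  apply: (M_left) => a; apply: M_left => a'; apply: M_2tf.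
  (* Extracting [a' ** a] from [q] at once yields a factor 2, extracting [a'] and then [a] a factor
     4. *)
  have [_ q_a'am _] := AM (a' ** a) m.
  have [_ q_a' _] := AM a' (a *l m); have [_ q_a _] := AM a m.
  move: q_a'am; rewrite lactA q_a' q_a lactMn [LHS]mulr2n lactA.
  by move/(canRL (addrK _)); rewrite subrr.
have d0 a : d a = 0.
  by apply: M_faithful.1 => m; have [<- _ _] := AM a m; rewrite q0 lactr0.
have e0 b : e b = 0.
  by apply: M_faithful.2 => m; have [<- _] := MB m b; rewrite q0 ract0l.
(* Elements of the corner [M] multiply to zero, so [orth] applies. *)
have MM m m' : p m *l m' + p m' *l m = 0 /\ m *r r m' + m' *r r m = 0.
  have mm0 : iM m ** iM m' + iM m' ** iM m = 0.
    by rewrite !tri_mulE !tri_addE !tri0E.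
  have := orth _ _ mm0.
  by rewrite !DM !tri_mulE !tri_addE !tri0E tri_zeroE => -[[->] [->]].
have p0 m : p m = 0.
  apply: M_faithful.1 => m'; apply: M_right => b.
  by have [+ _] := MM m (m' *r b); have [_ ->] := MB m' b; rewrite !tri0E lractA.
have r0 m : r m = 0.
  apply: M_faithful.2 => m'; apply: M_left => a.
  (* Here the multiplier comes from the left, since [r] vanishes on [a *l m']. *)
  have [_] := MM m (a *l m'); have [_ _ ->] := AM a m'.
  by rewrite !tri0E lractA.
move=> x; rewrite (tri_decomp x) !D_add.
by rewrite DA DM DB d0 p0 q0 r0 e0 !tri_addE !tri0E.
Qed.
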